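(* Let $\mathcal{R}$ be a commutative ring with unity, $\mathcal{A}$ a unital $\mathcal{R}$-algebra and $\mathcal{M}$ a unital $\mathcal{A}$-bimodule. Consider a derivation $\mathcal{D}:\mathcal{A}\ltimes\mathcal{M}\to\mathcal{A}\ltimes\mathcal{M}$, written as $\mathcal{D}=(\mathcal{D}_{\mathcal{A}}+T,\mathcal{D}_{\mathcal{M}}+S)$. Then the following assertions hold. (1) If $\mathcal{D}$ is inner, then $T=0$ and both $S$ and $\mathcal{D}_{\mathcal{M}}$ are inner. (2) The converse holds if we assume that $l.\mathrm{Ann}_{\mathcal{A}}(\mathcal{M})\cap r.\mathrm{Ann}_{\mathcal{A}}(\mathcal{M})=0$; that is, under this assumption, if $T=0$ and both $S$ and $\mathcal{D}_{\mathcal{M}}$ are inner, then $\mathcal{D}$ is inner.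
   Context: $\mathcal{A}\ltimes\mathcal{M}$ is the trivial extension algebra: $\mathcal{A}\times\mathcal{M}$ with componentwise addition and scalar multiplication and product $(a,m)(b,n)=(ab,an+mb)$. Every $\mathcal{R}$-linear map $\mathcal{D}$ on $\mathcal{A}\ltimes\mathcal{M}$ has the form $\mathcal{D}(a,m)=(\mathcal{D}_{\mathcal{A}}(a)+T(m),\mathcal{D}_{\mathcal{M}}(a)+S(m))$ with linear maps $\mathcal{D}_{\mathcal{A}}:\mathcal{A}\to\mathcal{A}$, $\mathcal{D}_{\mathcal{M}}:\mathcal{A}\to\mathcal{M}$, $T:\mathcal{M}\to\mathcal{A}$, $S:\mathcal{M}\to\mathcal{M}$; one writes $\mathcal{D}=(\mathcal{D}_{\mathcal{A}}+T,\mathcal{D}_{\mathcal{M}}+S)$. It is known that $\mathcal{D}$ is a derivation if and only if $\mathcal{D}_{\mathcal{A}}$ and $\mathcal{D}_{\mathcal{M}}$ are derivations, $T$ is an $\mathcal{A}$-bimodule homomorphism with $T(m)n+mT(n)=0$ for all $m,n\in\mathcal{M}$, and $S$ is a module generalized $\mathcal{D}_{\mathcal{A}}$-derivation, i.e. $S(am)=aS(m)+\mathcal{D}_{\mathcal{A}}(a)m$ and $S(ma)=S(m)a+m\mathcal{D}_{\mathcal{A}}(a)$ for all $a\in\mathcal{A},m\in\mathcal{M}$. $S$ is inner if there is $a_0\in\mathcal{A}$ with $S(m)=a_0m-ma_0$ for all $m\in\mathcal{M}$. $\mathcal{D}_{\mathcal{M}}$ is inner if there is $m_0\in\mathcal{M}$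 with $\mathcal{D}_{\mathcal{M}}(a)=m_0a-am_0$ for all $a\in\mathcal{A}$. $\mathcal{D}$ is inner if it is $x\mapsto x_0x-xx_0$ for some $x_0\in\mathcal{A}\ltimes\mathcal{M}$. $l.\mathrm{Ann}_{\mathcal{A}}(\mathcal{M})=\{r\in\mathcal{A}: r\mathcal{M}=0\}$ and $r.\mathrm{Ann}_{\mathcal{A}}(\mathcal{M})=\{r\in\mathcal{A}:\mathcal{M}r=0\}$. *)

(* Defs.v *)
From HB Require Import structures.
From mathcomp Require Import all_boot all_order all_algebra.

Set Implicit Arguments.
Unset Strict Implicit.
Unset Printing Implicit Defensive.

Import GRing.Theory.
Local Open Scope ring_scope.


(* R-algebras with a possibly zero carrier.  MathComp's algType extends
   nzRingType, hence excludes the zero algebra; and HB refuses a new structure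
   joining pzRingType and lmodType R, since lSemiAlgType is already one.  So
   the product is a field of the mixin, and the pzRingType structure is derived
   from it below. *)
HB.mixin Record Lmodule_isPzAlgebra (R : comPzRingType) A
    of GRing.Lmodule R A := {
  amul : A -> A -> A;
  aone : A;
  amulA : associative amul;
  amul1l : left_id aone amul;
  amul1r : right_id aone amul;
  amulDl : left_distributive amul +%R;
  amulDr : right_distributive amul +%R;
  ascaleAl : forall (k : R) (a b : A), k *: amul a b = amul (k *: a) b;
  ascaleAr : forall (k : R) (a b : A), k *: amul a b = amul a (k *: b)
}.

#[short(type="pzAlgType")]
HB.structure Definition PzAlgebra (R : comPzRingType) :=
  {A of Lmodule_isPzAlgebra R A & GRing.Lmodule R A}.

HB.instance Definition _ (R : comPzRingType) (A : pzAlgType R) :=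
  GRing.Zmodule_isPzRing.Build (PzAlgebra.sort A)
    amulA amul1l amul1r amulDl amulDr.

Definition pzAlg_of_alg (R : comPzRingType) (A : algType R) : pzAlgType R :=
  HB.pack_for (pzAlgType R) (GRing.Algebra.sort A)
    (Lmodule_isPzAlgebra.Build R A (@mulrA A) (@mul1r A) (@mulr1 A)
       (@mulrDl A) (@mulrDr A) (@scalerAl R A) (@scalerAr R A)).

(* The actions are fields rather than library module structures over A and its
   opposite ring, because the carrier already has its lmodType R structure and
   a type carries at most one lmodType instance. *)
HB.mixin Record isBimodule (R : comPzRingType) (A : pzAlgType R) M
    of GRing.Lmodule R M := {
  lact : A -> M -> M;
  ract : M -> A -> M;
  lactDl : forall (a b : A) (m : M), lact (a + b) m = lact a m + lact b m;
  lactDr : forall (a : A) (m n : M), lact a (m + n) = lact a m + lact a n;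
  lactZl : forall (k : R) (a : A) (m : M), lact (k *: a) m = k *: lact a m;
  lactZr : forall (k : R) (a : A) (m : M), lact a (k *: m) = k *: lact a m;
  lactA : forall (a b : A) (m : M), lact (a * b) m = lact a (lact b m);
  lact1 : forall m : M, lact 1 m = m;
  ractDl : forall (m n : M) (a : A), ract (m + n) a = ract m a + ract n a;
  ractDr : forall (m : M) (a b : A), ract m (a + b) = ract m a + ract m b;
  ractZl : forall (k : R) (m : M) (a : A), ract (k *: m) a = k *: ract m a;
  ractZr : forall (k : R) (m : M) (a : A), ract m (k *: a) = k *: ract m a;
  ractA : forall (m : M) (a b : A), ract m (a * b) = ract (ract m a) b;
  ract1 : forall m : M, ract m 1 = m;
  lractA : forall (a : A) (m : M) (b : A),
    ract (lact a m) b = lact a (ract m b)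
}.

#[short(type="bimodType")]
HB.structure Definition Bimodule (R : comPzRingType) (A : pzAlgType R) :=
  {M of isBimodule R A M & GRing.Lmodule R M}.

Notation "a *< m" := (lact a m) (at level 40, left associativity) : ring_scope.
Notation "m >* a" := (ract m a) (at level 40, left associativity) : ring_scope.

Local Lemma eq_pair (U V : Type) (x y : U * V) :
  x.1 = y.1 -> x.2 = y.2 -> x = y.
Proof. by case: x y => [? ?] [? ?] /= -> ->. Qed.

Section TrivialExtension.
Variables (R : comPzRingType) (A : pzAlgType R) (M : bimodType A).

Definition trivext : Type := (A * M)%type.

HB.instance Definition _ := GRing.Lmodule.copy trivext (A * M)%type.

Implicit Types x y z : trivext.

Definition trivext_one : trivext := (1, 0).
Definition trivext_mul x y : trivext := (x.1 * y.1, x.1 *< y.2 + x.2 >* y.1).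

Fact lactr0 (a : A) : a *< (0 : M) = 0.
Proof. by have := lactZr 0 a (0 : M); rewrite !scale0r. Qed.

Fact ract0r (a : A) : (0 : M) >* a = 0.
Proof. by have := ractZl 0 (0 : M) a; rewrite !scale0r. Qed.

Fact trivext_mulA : associative trivext_mul.
Proof.
move=> x y z; apply: eq_pair; rewrite /= ?mulrA //.
by rewrite lactDr ractDl lactA ractA lractA addrA.
Qed.

Fact trivext_mul1 : left_id trivext_one trivext_mul.
Proof.
by case=> a m; rewrite /trivext_mul /= mul1r lact1 ract0r addr0.
Qed.

Fact trivext_mulr1 : right_id trivext_one trivext_mul.
Proof.
by case=> a m; rewrite /trivext_mul /= mulr1 ract1 lactr0 add0r.
Qed.

Fact trivext_mulDl : left_distributive trivext_mul +%R.
Proof.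
move=> x y z; apply: eq_pair; rewrite /= ?mulrDl //.
by rewrite lactDl ractDl addrACA.
Qed.

Fact trivext_mulDr : right_distributive trivext_mul +%R.
Proof.
move=> x y z; apply: eq_pair; rewrite /= ?mulrDr //.
by rewrite lactDr ractDr addrACA.
Qed.

Fact trivext_scaleAl (k : R) x y :
  k *: trivext_mul x y = trivext_mul (k *: x) y.
Proof.
apply: eq_pair; rewrite /= ?ascaleAl //.
by rewrite scalerDr lactZl ractZl.
Qed.

Fact trivext_scaleAr (k : R) x y :
  k *: trivext_mul x y = trivext_mul x (k *: y).
Proof.
apply: eq_pair; rewrite /= ?ascaleAr //.
by rewrite scalerDr lactZr ractZr.
Qed.

HB.instance Definition _ := Lmodule_isPzAlgebra.Build R trivext
  trivext_mulA trivext_mul1 trivext_mulr1 trivext_mulDl trivext_mulDr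
  trivext_scaleAl trivext_scaleAr.

HB.instance Definition _ :=
  GRing.PzRing.copy trivext (PzAlgebra.sort (PzAlgebra.clone R trivext _)).

Lemma trivextME (a b : A) (m n : M) :
  ((a, m) : trivext) * (b, n) = (a * b, a *< n + m >* b).
Proof. by []. Qed.

End TrivialExtension.

Section Derivations.
Variables (R : comPzRingType) (A : pzAlgType R).

Definition derivation (f : {linear A -> A}) : Prop :=
  forall x y : A, f (x * y) = f x * y + x * f y.

Definition inner (f : A -> A) : Prop :=
  exists x0 : A, forall x : A, f x = x0 * x - x * x0.

Variable M : bimodType A.

Definition inner_der (f : A -> M) : Prop :=
  exists m0 : M, forall a : A, f a = m0 >* a - a *< m0.

Definition inner_end (f : M -> M) : Prop :=
  exists a0 : A, forall m : M, f m = a0 *< m - m >* a0.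

Definition lAnn (r : A) : Prop := forall m : M, r *< m = 0.
Definition rAnn (r : A) : Prop := forall m : M, m >* r = 0.

End Derivations.

Local Lemma ex_linear (R : pzRingType) (U V : lmodType R) (f : U -> V) :
  linear f -> exists g : {linear U -> V}, g =1 f.
Proof.
move=> fL; pose fM := GRing.isLinear.Build R U V *:%R f fL.
by exists (HB.pack f fM : {linear U -> V}).
Qed.

Section Components.
Variables (R : comPzRingType) (A : pzAlgType R) (M : bimodType A).

(* D = (DA + T, DM + S) *)
Definition trivext_components (D : {linear trivext M -> trivext M})
    (DA : {linear A -> A}) (T : {linear M -> A})
    (DM : {linear A -> M}) (S : {linear M -> M}) : Prop :=
  forall (a : A) (m : M), D (a, m) = (DA a + T m, DM a + S m).

Lemma trivext_componentsP (D : {linear trivext M -> trivext M}) :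
  exists DA T DM S, @trivext_components D DA T DM S.
Proof.
pose i1 (a : A) : trivext M := (a, 0).
pose i2 (m : M) : trivext M := (0, m).
have l1 (k : R) (a b : A) : i1 (k *: a + b) = k *: i1 a + i1 b.
  by apply: eq_pair => //=; rewrite scaler0 addr0.
have l2 (k : R) (m n : M) : i2 (k *: m + n) = k *: i2 m + i2 n.
  by apply: eq_pair => //=; rewrite scaler0 addr0.
have DAl : linear (fun a => (D (i1 a)).1) by move=> k a b; rewrite l1 linearP.
have DMl : linear (fun a => (D (i1 a)).2) by move=> k a b; rewrite l1 linearP.
have Tl : linear (fun m => (D (i2 m)).1) by move=> k m n; rewrite l2 linearP.
have Sl : linear (fun m => (D (i2 m)).2) by move=> k m n; rewrite l2 linearP.
have [DA DAE] := ex_linear DAl; have [DM DME] := ex_linear DMl.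
have [T TE] := ex_linear Tl; have [S SE] := ex_linear Sl.
exists DA, T, DM, S => a m; rewrite DAE DME TE SE.
have -> : ((a, m) : trivext M) = i1 a + i2 m.
  by apply: eq_pair; rewrite /= ?addr0 ?add0r.
by rewrite linearD.
Qed.

End Components.

(* Main.v *)
Require Import Defs.
From mathcomp Require Import all_boot all_order all_algebra.

Set Implicit Arguments.
Unset Strict Implicit.
Unset Printing Implicit Defensive.

Import GRing.Theory.
Local Open Scope ring_scope.

(** The commutator of (a0, m0) and (a, m) in the trivial extension has first
    component a0 a - a a0 and second component
    (m0 a - a m0) + (a0 m - m a0) (lemma [trivext_comm]).  The first component
    does not see m, and the second one splits into an inner derivation of A
    into M and an inner endomorphism of M.  So if D is inner, evaluating at
    (0, m) and (a, 0) shows that T vanishes and that a0 and m0 witness that S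
    and DM are inner.

    Conversely, let T = 0, let a0 implement S and m0 implement DM.  The
    candidate (a0, m0) implements D as soon as DA a = a0 a - a a0 for all a.
    Since D is a derivation, S is a generalized DA-derivation (lemmas
    [derivation_lact] and [derivation_ract]); it is also a generalized
    derivation along the commutator with a0, since it is implemented by a0.
    Comparing the two shows that DA a - (a0 a - a a0) kills M on both sides
    (lemmas [inner_end_lAnn] and [inner_end_rAnn]), hence is 0 when the two
    annihilators meet trivially. *)

Section BimoduleSubtraction.
Variables (R : comPzRingType) (A : pzAlgType R) (M : bimodType A).
Implicit Types (a b : A) (m n : M).

Lemma lact0r m : (0 : A) *< m = 0.
Proof. by have := lactZl 0 (0 : A) m; rewrite !scale0r. Qed.

Lemma ractr0 m : m >* (0 : A) = 0.
Proof. by have := ractZr 0 m (0 : A); rewrite !scale0r. Qed.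

Lemma lactBl a b m : (a - b) *< m = a *< m - b *< m.
Proof. by rewrite lactDl -scaleN1r lactZl scaleN1r. Qed.

Lemma lactBr a m n : a *< (m - n) = a *< m - a *< n.
Proof. by rewrite lactDr -scaleN1r lactZr scaleN1r. Qed.

Lemma ractBl m n a : (m - n) >* a = m >* a - n >* a.
Proof. by rewrite ractDl -scaleN1r ractZl scaleN1r. Qed.

Lemma ractBr m a b : m >* (a - b) = m >* a - m >* b.
Proof. by rewrite ractDr -scaleN1r ractZr scaleN1r. Qed.

Lemma trivext_comm a0 m0 a m :
  ((a0, m0) : trivext M) * (a, m) - ((a, m) : trivext M) * (a0, m0) =
  (a0 * a - a * a0, (m0 >* a - a *< m0) + (a0 *< m - m >* a0)).
Proof.
rewrite !trivextME; congr pair => /=.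
by rewrite [a0 *< m + _]addrC opprD addrACA.
Qed.

End BimoduleSubtraction.

Section Components.
Variables (R : comPzRingType) (A : pzAlgType R) (M : bimodType A).
Variables (D : {linear trivext M -> trivext M}).
Variables (DA : {linear A -> A}) (T : {linear M -> A}).
Variables (DM : {linear A -> M}) (S : {linear M -> M}).
Hypothesis D_comp : trivext_components D DA T DM S.

Lemma components_left a : D (a, 0) = (DA a, DM a).
Proof. by rewrite D_comp !linear0 !addr0. Qed.

Lemma components_right m : D (0, m) = (T m, S m).
Proof. by rewrite D_comp !linear0 !add0r. Qed.

(** Second component of the Leibniz rule for (a, 0) (0, m) = (0, a m). *)
Lemma derivation_lact a m :
  derivation D -> S (a *< m) = a *< S m + DA a *< m.
Proof.
move=> /(_ (a, 0) (0, m)).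
rewrite trivextME mulr0 ract0r addr0 components_left !components_right.
rewrite !trivextME => -[_ ->].
by rewrite ractr0 ract0r !addr0 addrC.
Qed.

(** Second component of the Leibniz rule for (0, m) (a, 0) = (0, m a). *)
Lemma derivation_ract m a :
  derivation D -> S (m >* a) = S m >* a + m >* DA a.
Proof.
move=> /(_ (0, m) (a, 0)).
rewrite trivextME mul0r lactr0 add0r components_left !components_right.
rewrite !trivextME => -[_ ->].
by rewrite lactr0 lact0r !add0r.
Qed.

End Components.

(** The next two lemmas say that a generalized derivation determines its
    underlying derivation up to the annihilators: an inner S is generalized
    along both DA and the commutator with a0. *)
Lemma inner_end_lAnn (R : comPzRingType) (A : pzAlgType R) (M : bimodType A)
    (DA : A -> A) (S : M -> M) (a0 a : A) :
  (forall m, S m = a0 *< m - m >* a0) ->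
  (forall m, S (a *< m) = a *< S m + DA a *< m) ->
  lAnn M (DA a - (a0 * a - a * a0)).
Proof.
move=> S_inner S_lact m.
have /eqP := S_lact m.
rewrite addrC -subr_eq => /eqP DAm.
rewrite 2!lactBl -DAm !S_inner lactBr !lactA lractA.
by rewrite opprB addrA subrK subrr.
Qed.

Lemma inner_end_rAnn (R : comPzRingType) (A : pzAlgType R) (M : bimodType A)
    (DA : A -> A) (S : M -> M) (a0 a : A) :
  (forall m, S m = a0 *< m - m >* a0) ->
  (forall m, S (m >* a) = S m >* a + m >* DA a) ->
  rAnn M (DA a - (a0 * a - a * a0)).
Proof.
move=> S_inner S_ract m.
have /eqP := S_ract m.
rewrite addrC -subr_eq => /eqP mDA.
rewrite 2!ractBr -mDA !S_inner ractBl !ractA lractA.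
by rewrite opprB [_ + (_ - _)]addrC addrA subrK subrr.
Qed.

Theorem theorem3p12 (R : comPzRingType) (A : pzAlgType R) (M : bimodType A)
    (D : {linear trivext M -> trivext M})
    (DA : {linear A -> A}) (T : {linear M -> A})
    (DM : {linear A -> M}) (S : {linear M -> M})
    (D_der : derivation D)
    (D_comp : trivext_components D DA T DM S) :
  (inner D -> (forall m : M, T m = 0) /\ inner_end S /\ inner_der DM) /\
  ((forall r : A, lAnn M r /\ rAnn M r -> r = 0) ->
   (forall m : M, T m = 0) /\ inner_end S /\ inner_der DM -> inner D).
Proof.
split=> [[[a0 m0] D_inner]|ann0 [T0 [[a0 S_inner] [m0 DM_inner]]]].
- have DE m : (T m, S m) = (0, a0 *< m - m >* a0).
    rewrite -(components_right D_comp) D_inner trivext_comm.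
    by rewrite mulr0 mul0r ractr0 lact0r !subrr add0r.
  split=> [m|]; first by case: (DE m).
  split; first by exists a0 => m; case: (DE m).
  exists m0 => a.
  suff [] : (DA a, DM a) = (a0 * a - a * a0, m0 >* a - a *< m0) by [].
  rewrite -(components_left D_comp) D_inner trivext_comm.
  by rewrite lactr0 ract0r subrr addr0.
exists (a0, m0) => -[a m].
rewrite trivext_comm D_comp T0 addr0 DM_inner S_inner; congr pair.
apply/eqP; rewrite -subr_eq0; apply/eqP/ann0; split.
  apply: (inner_end_lAnn S_inner) => n.
  exact: derivation_lact D_comp _ _ D_der.
apply: (inner_end_rAnn S_inner) => n.
exact: derivation_ract D_comp _ _ D_der.
Qed.
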